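(* Let $(M,d)$ be a finite metric space with $N+1$ points and a distinguished point $0\in M$. For every $\mu\in\mathcal{F}(M)$ and every normalised stochastic basis $\beta=(b_n)_{n=1}^N\in B(M)$ we have $$b^*(\mu)=\delta^*(\mu)+T_\beta\,\delta^*(\mu)+\dots+T_\beta^N\,\delta^*(\mu)=\sum_{n=0}^\infty T_\beta^n\,\delta^*(\mu)=\big(I-T_\beta\big)^{-1}\delta^*(\mu).$$
   Context: $\mathrm{Lip}_0(M)$ is the space of functions $f:M\to\mathbb{R}$ with $f(0)=0$, normed by the least Lipschitz constant; $\mathcal{F}(M)$ is its dual normed space, of dimension $N$. An element of $\mathcal{F}(M)$ is represented by a function $\mu:M\to\mathbb{R}$ acting by $\langle\mu,f\rangle=\sum_{x\in M}\mu(x)f(x)$; the value $\mu(0)$ is irrelevant, and $\delta_x$ denotes the indicator function of $x$. Stochastic retractions and stochastic bases: for $S\subset M$ with $0\in S$, a stochastic retraction onto $S$ is the linear projection of $\mathcal{F}(M)$ onto the span of $\{\delta_x:x\in S\}$ determined by $\delta_x\mapsto R(x)$ where each $R(x)$ is a probability measure on $S$ and $R(x)=\delta_x$ for $x\in S$; a basis is stochastic if its canonical projections $P_n(x)=\sum_{i\le n}b_i^*(x)b_i$ are all stochastic retractions. A stochastic basis is normalised, written $(b_n)\in B(M)$, if $$b_n=\delta_{F(n)}-\sum_{i<n}\lambda_{n,i}\delta_{F(i)},\quad n=1,\dots,N,$$ for some bijection $F:\{0,\dots,N\}\to M$ with $F(0)=0$ and some $(\lambda_{n,i})_{0\le i<n\le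 N}\subset[0,1]$ with $\sum_{i<n}\lambda_{n,i}=1$ for each $n\ge 1$. $(b_n^* )$ is the dual basis. Identify $M$ with $\{0,\dots,N\}$ through $F$, so $\delta_n=\delta_{F(n)}$. $T_\beta$ is the $(N+1)\times(N+1)$ matrix, with rows and columns indexed by $0,\dots,N$, whose $(i,n)$ entry is $\lambda_{n,i}$ if $i<n$ and $0$ otherwise (strictly upper triangular). For $\mu\in\mathcal{F}(M)$, $\delta^*(\mu)=(\delta_0^*(\mu),\dots,\delta_N^*(\mu))^{t}$ is the column vector of coefficients of the unique representation $\mu=\sum_{n=0}^N\delta_n^*(\mu)\delta_n$ with $\sum_{n=0}^N\delta^*_n(\mu)=0$, and $b^*(\mu)=(0,b_1^*(\mu),\dots,b_N^*(\mu))^t$. *)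

(* Defs.v *)
From HB Require Import structures.
From mathcomp Require Import all_boot all_order all_algebra.
From mathcomp Require Import all_classical all_reals all_analysis.

Set Implicit Arguments.
Unset Strict Implicit.
Unset Printing Implicit Defensive.

Import Order.TTheory GRing.Theory Num.Theory.
Import numFieldNormedType.Exports.

Local Open Scope ring_scope.

#[short(type="finMetricType")]
HB.structure Definition FinMetric (K : numDomainType) :=
  { M of Finite M & Metric K M }.

Section LipschitzFree.
Context {R : realType} {M : finMetricType R}.
Implicit Types (o x y : M) (S : {set M}).

Definition ev x (f : {ffun M -> R^o}) : R^o := f x.

Lemma ev_is_linear x : linear (ev x).
Proof. by move=> a f g; rewrite /ev !ffunE. Qed.

HB.instance Definition _ x :=
  GRing.isLinear.Build R {ffun M -> R^o} R^o _ (ev x) (ev_is_linear x).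

(* Since M is finite, every function on M is Lipschitz: as a vector space,
   Lip_0(M) is the space of all functions vanishing at the base point o. *)
Definition Lip0 o : {vspace {ffun M -> R^o}} := lker (linfun (ev o)).

Lemma mem_Lip0 o (f : {ffun M -> R^o}) : (f \in Lip0 o) = (f o == 0).
Proof. by rewrite memv_ker lfunE. Qed.

Definition lip_norm o (f : subvs_of (Lip0 o)) : R :=
  inf [set L : R | 0 <= L /\
    forall x y, `|vsval f x - vsval f y| <= L * mdist x y]%classic.

(* The dual of Lip_0(M). In finite dimension all linear functionals are
   bounded (see LipFree_bounded), so this is also the normed-space dual. *)
Definition LipFree o := 'Hom(subvs_of (Lip0 o), R^o).

Definition LipFree_norm o (phi : LipFree o) : R :=
  sup [set `|phi f| | f in [set f | lip_norm f <= 1]]%classic.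

Definition pairing o (mu : {ffun M -> R}) (f : subvs_of (Lip0 o)) : R^o :=
  \sum_x mu x * vsval f x.

Lemma pairing_is_linear o mu : linear (@pairing o mu).
Proof.
move=> a f g; rewrite /pairing scaler_sumr -big_split /=.
apply: eq_bigr => x _.
by rewrite !ffunE mulrDr /GRing.scale /= mulrCA.
Qed.

HB.instance Definition _ o mu :=
  GRing.isLinear.Build R (subvs_of (Lip0 o)) R^o _ (@pairing o mu)
    (pairing_is_linear mu).

Definition repr_by o (mu : {ffun M -> R}) : LipFree o :=
  linfun (@pairing o mu).

Lemma repr_byE o mu f : @repr_by o mu f = \sum_x mu x * vsval f x.
Proof. by rewrite lfunE. Qed.

Definition indicator x : {ffun M -> R} := [ffun y => (y == x)%:R].

Definition delta o x : LipFree o := repr_by o (indicator x).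

Lemma deltaE o x f : delta o x f = vsval f x.
Proof.
rewrite repr_byE (bigD1 x) //= !ffunE eqxx mul1r big1 ?addr0 // => y yx.
by rewrite ffunE (negbTE yx) mul0r.
Qed.

Lemma delta_base o : delta o o = 0.
Proof.
apply/lfunP => f; rewrite deltaE zero_lfunE.
by apply/eqP; rewrite -mem_Lip0 subvsP.
Qed.

Lemma repr_by_delta o mu : repr_by o mu = \sum_x mu x *: delta o x.
Proof.
apply/lfunP => f; rewrite repr_byE sum_lfunE.
by apply: eq_bigr => x _; rewrite scale_lfunE deltaE.
Qed.

Lemma LipFree_repr o (phi : LipFree o) : exists mu, phi = repr_by o mu.
Proof.
pose e x : {ffun M -> R^o} := [ffun y => ((y == x) && (x != o))%:R].
have eL x : e x \in Lip0 o by rewrite mem_Lip0 ffunE (eq_sym o x) andbN.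
exists [ffun x => phi (vsproj (Lip0 o) (e x))]; apply/lfunP => f.
have fE : f = \sum_x vsval f x *: vsproj (Lip0 o) (e x).
  apply: val_inj; rewrite /= linear_sum /=.
  apply/ffunP => y; rewrite sum_ffunE (bigD1 y) //= big1 => [|x xy].
    rewrite addr0 vsprojK // !ffunE eqxx /=.
    case: eqVneq => [->|_]; last by rewrite /GRing.scale /= mulr1.
    by rewrite scaler0; apply/eqP; rewrite -mem_Lip0; exact: subvsP.
  by rewrite vsprojK // !ffunE eq_sym (negbTE xy) scaler0.
rewrite [in LHS]fE linear_sum repr_byE; apply: eq_bigr => x _.
by rewrite linearZ ffunE mulrC.
Qed.

Lemma lip_normP o (f : subvs_of (Lip0 o)) x y :
  `|vsval f x - vsval f y| <= lip_norm f * mdist x y.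
Proof.
set A := [set L : R | 0 <= L /\
    forall x y, `|vsval f x - vsval f y| <= L * mdist x y]%classic.
have [->|xy] := eqVneq x y; first by rewrite mdistxx mulr0 subrr normr0.
have d0 : 0 < mdist x y by rewrite mdist_gt0.
rewrite -ler_pdivrMr //; apply: lb_le_inf; last first.
  by move=> L [_ /(_ x y)]; rewrite ler_pdivrMr.
exists (\sum_u \sum_v `|vsval f u - vsval f v| / mdist u v); split.
  by do 2! [apply: sumr_ge0 => ? _]; rewrite divr_ge0 ?mdist_ge0.
move=> u v; have [->|uv] := eqVneq u v.
  by rewrite mdistxx mulr0 subrr normr0.
rewrite -ler_pdivrMr ?mdist_gt0 // (bigD1 u) //= (bigD1 v) //= -addrA lerDl.
rewrite addr_ge0 ?sumr_ge0 // => *; first by rewrite divr_ge0 ?mdist_ge0.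
by apply: sumr_ge0 => *; rewrite divr_ge0 ?mdist_ge0.
Qed.

Lemma LipFree_bounded o (phi : LipFree o) :
  exists C : R, forall f, `|phi f| <= C * lip_norm f.
Proof.
have [mu ->] := LipFree_repr phi.
exists (\sum_x `|mu x| * mdist x o) => f.
rewrite repr_byE mulr_suml (le_trans (ler_norm_sum _ _ _)) //.
apply: ler_sum => x _; rewrite normrM -mulrA ler_wpM2l // mulrC.
have /eqP fo : vsval f o == 0 by rewrite -mem_Lip0 subvsP.
by have := lip_normP f x o; rewrite fo subr0 mulrC.
Qed.

Definition probability_on S (p : {ffun M -> R}) : Prop :=
  [/\ forall x, 0 <= p x,
      forall x, x \notin S -> p x = 0
    & \sum_x p x = 1].

(* These conditions force P to be a projection onto the span of the delta_x,
   x in S. *)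
Definition stochastic_retraction o S (P : LipFree o -> LipFree o) : Prop :=
  [/\ o \in S, linear P &
      exists r : M -> {ffun M -> R},
        [/\ forall x, probability_on S (r x),
            forall x, x \in S -> r x = indicator x
          & forall x, P (delta o x) = repr_by o (r x)]].

(* Bases are tuples indexed from 0: the entry b_(k+1) of the basis
   b_1, ..., b_N is tnth b k for k : 'I_N. The same shift is used below, where
   lift ord0 k : 'I_N.+1 is the index k+1. *)
Definition canonical_projection o N (b : N.-tuple (LipFree o)) (n : 'I_N)
    (mu : LipFree o) : LipFree o :=
  \sum_(i < N | (i <= n)%N) coord b i mu *: tnth b i.

Definition stochastic_basis o N (b : N.-tuple (LipFree o)) : Prop :=
  basis_of fullv b /\
  forall n, exists S, stochastic_retraction S (canonical_projection b n).

(* b is in normal form with respect to the enumeration F and the weights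
   lam n i; only the weights with i < n are relevant. *)
Definition normal_form o N (F : 'I_N.+1 -> M) (lam : 'I_N.+1 -> 'I_N.+1 -> R)
    (b : N.-tuple (LipFree o)) : Prop :=
  [/\ bijective F, F ord0 = o,
      forall n i : 'I_N.+1, (i < n)%N -> 0 <= lam n i <= 1,
      forall n : 'I_N.+1, (0 < n)%N -> \sum_(i < N.+1 | (i < n)%N) lam n i = 1
    & forall k : 'I_N, tnth b k = delta o (F (lift ord0 k)) -
        \sum_(i < N.+1 | (i < lift ord0 k)%N)
          lam (lift ord0 k) i *: delta o (F i)].

(* b is in B(M), as witnessed by F and lam. F and the relevant weights are
   determined by b, and the matrix T_b is defined through them. *)
Definition normalised_stochastic_basis o N (F : 'I_N.+1 -> M)
    (lam : 'I_N.+1 -> 'I_N.+1 -> R) (b : N.-tuple (LipFree o)) : Prop :=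
  stochastic_basis b /\ normal_form F lam b.

Definition T_mx N (lam : 'I_N.+1 -> 'I_N.+1 -> R) : 'M[R]_N.+1 :=
  \matrix_(i, n) if (i < n)%N then lam n i else 0.

Definition b_star o N (b : N.-tuple (LipFree o)) (mu : LipFree o) :
    'cV[R]_N.+1 :=
  \col_n oapp (fun k : 'I_N => coord b k mu) 0 (unlift ord0 n).

Definition balanced_coefs o N (F : 'I_N.+1 -> M) (mu : LipFree o)
    (c : 'cV[R]_N.+1) : Prop :=
  mu = \sum_n c n 0 *: delta o (F n) /\ \sum_n c n 0 = 0.

Definition delta_star o N (F : 'I_N.+1 -> M) (mu : LipFree o) : 'cV[R]_N.+1 :=
  xget 0 [set c | balanced_coefs F mu c]%classic.

Lemma balanced_coefs_exists o N (F : 'I_N.+1 -> M) (mu : LipFree o) :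
  bijective F -> F ord0 = o -> exists c, balanced_coefs F mu c.
Proof.
move=> bF F0; have [m ->] := LipFree_repr mu.
exists (\col_n (m (F n) - (n == ord0)%:R * \sum_x m x)); split.
  rewrite repr_by_delta (reindex F) /=; last exact: onW_bij.
  apply: eq_bigr => n _; rewrite mxE; case: eqVneq => [->|_].
    by rewrite F0 delta_base !scaler0.
  by rewrite mul0r subr0.
under eq_bigr => n _ do rewrite mxE.
rewrite sumrB -mulr_suml.
have -> : \sum_(n < N.+1) (n == ord0)%:R = 1 :> R.
  by rewrite (bigD1 ord0) //= big1 ?addr0 // => n /negbTE->.
rewrite mul1r [X in _ - X](reindex F) ?subrr //.
exact: onW_bij.
Qed.

Lemma balanced_coefs_unique o N (F : 'I_N.+1 -> M) (mu : LipFree o) c c' :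
    bijective F -> F ord0 = o ->
  balanced_coefs F mu c -> balanced_coefs F mu c' -> c = c'.
Proof.
move=> bF F0 [cE c0] [cE' c0'].
have E (n : 'I_N.+1) : n != ord0 -> c n 0 = c' n 0.
  move=> n0; pose f : {ffun M -> R^o} := indicator (F n).
  have fL : f \in Lip0 o.
    by rewrite mem_Lip0 ffunE -F0 (bij_eq bF) (eq_sym ord0) (negbTE n0).
  have H (a : 'cV[R]_N.+1) :
      (\sum_n a n 0 *: delta o (F n)) (vsproj (Lip0 o) f) = a n 0.
    rewrite sum_lfunE (bigD1 n) //= big1 => [|i i_n].
      rewrite addr0 scale_lfunE deltaE vsprojK // ffunE eqxx.
      by rewrite /GRing.scale /= mulr1.
    rewrite scale_lfunE deltaE vsprojK // ffunE (bij_eq bF) (negbTE i_n).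
    by rewrite /GRing.scale /= mulr0.
  by rewrite -(H c) -(H c') -cE -cE'.
apply/matrixP => i j; rewrite (ord1 j); have [->|] := eqVneq i ord0; last exact: E.
move: c0 c0'; rewrite (bigD1 ord0) //= => /eqP; rewrite addr_eq0 => /eqP ->.
rewrite (bigD1 ord0) //= => /eqP; rewrite addr_eq0 => /eqP ->.
by congr (- _); apply: eq_bigr.
Qed.

Lemma delta_starP o N (F : 'I_N.+1 -> M) (mu : LipFree o) :
  bijective F -> F ord0 = o -> balanced_coefs F mu (delta_star F mu).
Proof. by move=> bF F0; apply: xgetPex; apply: balanced_coefs_exists. Qed.

End LipschitzFree.

(* Main.v *)
Require Import Defs.
From HB Require Import structures.
From mathcomp Require Import all_boot all_order all_algebra.
From mathcomp Require Import all_classical all_reals all_analysis.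

(** Write v for the column b^*(mu), whose entry of index 0 is 0, and expand
    each b_n in mu = \sum_n v_n b_n as delta_n minus its weighted average of
    earlier delta_i.  Collecting the coefficient of delta_i yields
    v_i - \sum_(n > i) lam n i * v_n, the i-th entry of (1 - T) v.  The weights
    of each b_n with n > 0 add up to 1, and v_0 = 0, so the entries of (1 - T) v
    add up to 0: it is a balanced representation of mu, and by uniqueness
    (1 - T) v = delta^*(mu) (lemma [mul_subr_T_b_star]).

    What remains is the Neumann series of T.  Being strictly upper triangular,
    T satisfies T^(N+1) = 0 ([T_mx_nilpotent]), so the geometric sum
    1 + T + ... + T^N is an inverse of 1 - T, and the infinite series is
    constant from its partial sum of index N+1 on. *)

Set Implicit Arguments.
Unset Strict Implicit.
Unset Printing Implicit Defensive.

Import Order.TTheory GRing.Theory Num.Theory.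
Import numFieldNormedType.Exports.

Local Open Scope classical_set_scope.
Local Open Scope ring_scope.

(** The exponent counts superdiagonals: each multiplication by a strictly upper
    triangular matrix moves the support up by at least one more diagonal. *)
Lemma strict_upper_expr (R : pzRingType) N (A : 'M[R]_N.+1) :
    (forall i j : 'I_N.+1, (j <= i)%N -> A i j = 0) ->
  forall m (i j : 'I_N.+1), (j < i + m)%N -> (A ^+ m) i j = 0.
Proof.
move=> A0; elim=> [|m IHm] i j.
  by rewrite addn0 expr0 mxE => ji; rewrite -val_eqE /= gtn_eqF.
rewrite addnS ltnS exprSr -mulmxE mxE => jim; apply: big1 => k _.
have [kim|imk] := ltnP k (i + m); first by rewrite IHm ?mul0r.
by rewrite A0 ?mulr0 // (leq_trans jim).
Qed.

Lemma T_mx_nilpotent (R : realType) N (lam : 'I_N.+1 -> 'I_N.+1 -> R) n :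
  (N < n)%N -> T_mx lam ^+ n = 0.
Proof.
move=> Nn; apply/matrixP => i j; rewrite [RHS]mxE.
apply: strict_upper_expr => [{}i {}j ji|]; first by rewrite mxE ltnNge ji.
by rewrite (leq_trans (ltn_ord j)) // (leq_trans Nn) ?leq_addl.
Qed.

(** [1 - T] is the transpose of the change of family from [x] to
    [x n - \sum_(i < n) lam n i *: x i].  Taking [x] to be the evaluations gives
    the coefficients of [mu]; taking [x] constant gives their sum. *)
Lemma sum_subr_T_mx (R : realType) N (lam : 'I_N.+1 -> 'I_N.+1 -> R)
    (V : lmodType R) (x : 'I_N.+1 -> V) (v : 'cV[R]_N.+1) :
  \sum_i ((1 - T_mx lam) *m v) i 0 *: x i =
  \sum_n v n 0 *: (x n - \sum_(i < N.+1 | (i < n)%N) lam n i *: x i).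
Proof.
under eq_bigr do rewrite mulmxBl mul1mx mxE [X in _ + X]mxE scalerBl.
under [RHS]eq_bigr do rewrite scalerBr.
rewrite !sumrB; congr (_ - _).
under eq_bigr do rewrite mxE scaler_suml.
rewrite exchange_big; apply: eq_bigr => n _ /=.
rewrite scaler_sumr [RHS]big_mkcond; apply: eq_bigr => i _.
by rewrite mxE; case: ifP => _; rewrite ?mul0r ?scale0r // scalerA mulrC.
Qed.

(** The entry of index 0 of [b_star b mu] vanishes, so only the indices of
    basis vectors contribute. *)
Lemma sum_b_star (R : realType) (M : finMetricType R) (o : M) N
    (b : N.-tuple (LipFree o)) (mu : LipFree o) (V : lmodType R)
    (x : 'I_N.+1 -> V) :
  \sum_n b_star b mu n 0 *: x n =
  \sum_(k < N) coord b k mu *: x (lift ord0 k).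
Proof.
rewrite big_ord_recl mxE unlift_none scale0r add0r.
by apply: eq_bigr => k _; rewrite mxE liftK.
Qed.

(** The left-hand side is a representation of [mu] because it recombines the
    expansion of [mu] in the basis, and it is balanced because every basis
    vector has total mass 0. *)
Lemma mul_subr_T_b_star (R : realType) (M : finMetricType R) (o : M) N
    (F : 'I_N.+1 -> M) (lam : 'I_N.+1 -> 'I_N.+1 -> R)
    (b : N.-tuple (LipFree o)) (mu : LipFree o) :
    basis_of fullv b -> normal_form F lam b ->
  (1 - T_mx lam) *m b_star b mu = delta_star F mu.
Proof.
move=> bB [bF F0 _ lam1 bE].
apply: (balanced_coefs_unique bF F0 _ (delta_starP mu bF F0)); split.
  rewrite sum_subr_T_mx sum_b_star [LHS](coord_basis bB) ?memvf //.
  by apply: eq_bigr => k _; rewrite -bE (tnth_nth 0).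
have := sum_subr_T_mx lam (fun=> 1 : R^o) (b_star b mu).
under eq_bigr do rewrite /GRing.scale /= mulr1.
move=> ->; rewrite sum_b_star big1 // => k _.
under eq_bigr do rewrite /GRing.scale /= mulr1.
by rewrite lam1 // subrr scaler0.
Qed.

Theorem theorem3p6 (R : realType) (M : finMetricType R) (N : nat)
    (cardM : #|{: M}| = N.+1) (o : M)
    (mu : LipFree o) (b : N.-tuple (LipFree o))
    (F : 'I_N.+1 -> M) (lam : 'I_N.+1 -> 'I_N.+1 -> R)
    (hb : normalised_stochastic_basis F lam b) :
  [/\ b_star b mu = \sum_(n < N.+1) T_mx lam ^+ n *m delta_star F mu,
      series (fun n : nat => T_mx lam ^+ n *m delta_star F mu) @ \oo
        --> b_star b mu,
      1 - T_mx lam \in unitmx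
    & b_star b mu = invmx (1 - T_mx lam) *m delta_star F mu].
Proof.
have [[bB _] nf] := hb.
have bD := mul_subr_T_b_star mu bB nf.
set T := T_mx lam in bD *; set d := delta_star F mu in bD *.
have geom : (\sum_(n < N.+1) T ^+ n) *m (1 - T) = 1.
  have cT : GRing.comm (1 - T) (\sum_(n < N.+1) T ^+ n).
    apply: commr_sum => n _; apply: commrX; apply/commr_sym.
    by apply: commrB => //; exact: commr1.
  rewrite mulmxE -cT -opprB mulNr -subrX1 T_mx_nilpotent //.
  by rewrite sub0r opprK.
have [_ unitT] := mulmx1_unit geom.
have sumE : b_star b mu = \sum_(n < N.+1) T ^+ n *m d.
  by rewrite -mulmx_suml -bD mulmxA geom mul1mx.
split=> //; last by rewrite -bD mulKmx.
apply: cvg_near_cst; near=> n.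
have Nn : (N.+1 <= n)%N by near: n; exact: nbhs_infty_ge.
rewrite /series /= sumE (big_cat_nat (leq0n _) Nn) /= big_mkord.
rewrite -[RHS]addr0; congr (_ + _).
rewrite big_nat_cond big1 // => i /andP[/andP[Ni _] _].
by rewrite T_mx_nilpotent // mul0mx.
Unshelve. all: by end_near.
Qed.
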